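(* (1) For every $k\ge 2$, $K'(\mathit{ML}_k,3)=1$ if $k$ is even and $K'(\mathit{ML}_k,3)=2$ if $k$ is odd. (2) For every $k\ge 3$, $K'(\mathit{Pr}_k,3)=1$. (3) For every $k\ge 2$, $K'(\mathit{CPr}_k,3)=1$.
   Context: The Möbius ladder $\mathit{ML}_k$ is the graph on $2k$ vertices obtained from a cycle $u_0u_1\cdots u_{2k-1}u_0$ by adding the chords $u_iu_{i+k}$ for $0\le i<k$. The prism graph $\mathit{Pr}_k$ is the Cartesian product $C_k\times K_2$ on $2k$ vertices: two cycles $a_1\cdots a_k$ and $b_1\cdots b_k$ together with the edges $a_ib_i$. The crossed prism graph $\mathit{CPr}_k$ has $4k$ vertices: two cycles $a_1a_2\cdots a_{2k}a_1$ and $b_1b_2\cdots b_{2k}b_1$ together with the edges $a_{2i-1}b_{2i}$ and $a_{2i}b_{2i-1}$ for $1\le i\le k$. A proper $n$-edge coloring assigns to each edge a color from $\{1,\dots,n\}$ so that edges sharing an endpoint receive different colors. For a proper edge coloring and two distinct colors $a,b$, an edge-Kempe chain is a connected component of the subgraph formed by the edges colored $a$ or $b$; an edge-Kempe switch interchanges the colors $a$ and $b$ on one such chain. Two colorings are edge-Kempe equivalent if one is obtained from the other by a finite sequence of edge-Kempe switches. $K'(G,n)$ is the number of edge-Kempe equivalence classes of proper $n$-edge colorings of $G$. *)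

(* Defs.v *)
From mathcomp Require Import all_boot.
Set Implicit Arguments. Unset Strict Implicit. Unset Printing Implicit Defensive.

(* A simple graph on a finite vertex type V is given by a symmetric,
   irreflexive adjacency relation; its edges are the 2-sets {x,y}. *)
Definition edges_of (V : finType) (adj : rel V) : {set {set V}} :=
  [set e : {set V} | [exists x : V, exists y : V, adj x y && (e == [set x; y])]].

Definition edge_t (V : finType) (adj : rel V) := {e : {set V} | e \in edges_of adj}.

Definition coloring (V : finType) (adj : rel V) (n : nat) := {ffun edge_t adj -> 'I_n}.

Definition proper (V : finType) (adj : rel V) (n : nat) (c : coloring adj n) : bool :=
  [forall e : edge_t adj, forall f : edge_t adj,
     ((e != f) && (val e :&: val f != set0)) ==> (c e != c f)].

Definition kempe_rel (V : finType) (adj : rel V) (n : nat) (c : coloring adj n)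
  (a b : 'I_n) : rel V :=
  fun x y => [exists e : edge_t adj, (val e == [set x; y]) && ((c e == a) || (c e == b))].

Definition swap_col (n : nat) (a b z : 'I_n) : 'I_n :=
  if z == a then b else if z == b then a else z.

Definition kempe_switch (V : finType) (adj : rel V) (n : nat) (c : coloring adj n)
  (a b : 'I_n) (x : V) : coloring adj n :=
  [ffun e => if ((c e == a) || (c e == b)) &&
                [exists y in val e, connect (kempe_rel c a b) x y]
             then swap_col a b (c e) else c e].

Definition kempe_step (V : finType) (adj : rel V) (n : nat) (c d : coloring adj n) : bool :=
  [exists a : 'I_n, exists b : 'I_n, exists x : V,
     (a != b) && (d == kempe_switch c a b x)].

Definition kempe_equiv (V : finType) (adj : rel V) (n : nat) : rel (coloring adj n) :=
  connect (@kempe_step V adj n).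

Definition Kprime (V : finType) (adj : rel V) (n : nat) : nat :=
  #|[set [set d : coloring adj n | proper d && kempe_equiv c d]
      | c : coloring adj n & proper c]|.

Definition ML (k : nat) : rel 'I_(2 * k) :=
  fun i j => [|| (j == i.+1 %% (2 * k) :> nat), (i == j.+1 %% (2 * k) :> nat),
                 (j == i + k :> nat) | (i == j + k :> nat)].

(* prism C_k x K_2: vertex (i, s), s = false for a_i, true for b_i *)
Definition Pr (k : nat) : rel ('I_k * bool) :=
  fun u v => ((u.2 == v.2) && ((v.1 == u.1.+1 %% k :> nat) || (u.1 == v.1.+1 %% k :> nat)))
          || ((u.1 == v.1) && (u.2 != v.2)).

(* crossed prism: two 2k-cycles a_0..a_{2k-1}, b_0..b_{2k-1} (0-indexed) with
   edges a_{2m} b_{2m+1} and a_{2m+1} b_{2m} *)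
Definition CPr (k : nat) : rel ('I_(2 * k) * bool) :=
  fun u v => ((u.2 == v.2) && ((v.1 == u.1.+1 %% (2 * k) :> nat)
                               || (u.1 == v.1.+1 %% (2 * k) :> nat)))
          || [&& u.2 != v.2, (u.1./2 == v.1./2) & (u.1 != v.1 :> nat)].

Arguments ML : clear implicits.
Arguments Pr : clear implicits.
Arguments CPr : clear implicits.

(* Main.v *)
From mathcomp Require Import all_boot zify.
Require Import Defs.

Set Implicit Arguments. Unset Strict Implicit. Unset Printing Implicit Defensive.

(* Swapping colours a, b on any vertex set S that no edge coloured a or b leaves is a
   composition of Kempe switches, so chains never have to be computed.

   ML_k and Pr_k are cyclic ladders with k rungs.  At one rung the two rails either have
   equal colours or swap colours, so a colouring is either flat (both rails of each pair
   agree) or twisted (rails alternate between two colours, all rungs get the third one).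
   Flat colourings are cyclic words of length k over three letters without equal
   neighbours, and local Kempe switches bring every such word to 1 2 1 2 .. 0.  In Pr_k a
   twisted colouring becomes flat by switching one of the two long cycles.  In ML_k a
   twisted colouring exists only if k is odd, and then it is unique up to a permutation of
   colours; since an odd flat word uses all three colours, a switch leaves some rail pair
   unchanged and thus preserves flatness.

   In CPr_k, squares are joined by pairs of links.  The links use at most two colours, so
   one switch makes them all equal; then each square is 2-coloured and is itself a chain. *)

(** * Kempe switches on stable vertex sets *)

Section KempeSwitches.

Variables (V : finType) (adj : rel V) (n : nat).
Hypothesis adjC : symmetric adj.

Implicit Types (c d : coloring adj n.+1) (a b : 'I_n.+1) (S : pred V).

(** Reading colours off ordered pairs of vertices avoids carrying edge membership proofs; the value
    [ord0] on non-edges is a mere default. *)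
Definition ecol c (x y : V) : 'I_n.+1 :=
  if insub [set x; y] is Some e then c e else ord0.

Lemma ecolC c x y : ecol c x y = ecol c y x.
Proof. by rewrite /ecol setUC. Qed.

Lemma ecol_val c (e : edge_t adj) x y : val e = [set x; y] -> ecol c x y = c e.
Proof. by rewrite /ecol => <-; rewrite valK. Qed.

Lemma edge_ends (e : edge_t adj) : exists x y, adj x y /\ val e = [set x; y].
Proof.
have := valP e; rewrite inE => /existsP[x /existsP[y /andP[xy /eqP ->]]].
by exists x, y.
Qed.

Lemma adj_edge x y : adj x y -> exists e : edge_t adj, val e = [set x; y].
Proof.
move=> xy; have e_in : [set x; y] \in edges_of adj.
  by rewrite inE; apply/existsP; exists x; apply/existsP; exists y; rewrite xy /=.
by exists (exist (fun e : {set V} => e \in edges_of adj) _ e_in).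
Qed.

Lemma set2_inj (x y u v : V) :
  [set x; y] = [set u; v] -> (x = u /\ y = v) \/ (x = v /\ y = u).
Proof.
move=> E; have memE z : (z == x) || (z == y) = (z == u) || (z == v).
  by rewrite -!in_set2 E.
have := memE u; have := memE v; have := memE x; have := memE y.
rewrite !eqxx ?orbT => /esym/orP[]/eqP ? /esym/orP[]/eqP ? /orP[]/eqP ? /orP[]/eqP ?;
  by [left; split; congruence | right; split; congruence].
Qed.

Lemma edge_adj (e : edge_t adj) x y : val e = [set x; y] -> adj x y.
Proof.
have [u [v [uv ->]]] := edge_ends e.
by move=> /set2_inj[] [<- <-] //; rewrite adjC.
Qed.

Lemma kempe_relE c a b x y :
  kempe_rel c a b x y = adj x y && ((ecol c x y == a) || (ecol c x y == b)).
Proof.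
apply/existsP/andP => [[e /andP[/eqP ve ce]]|[xy cxy]].
  by rewrite (ecol_val c ve) (edge_adj ve).
have [e ve] := adj_edge xy; exists e.
by rewrite ve eqxx -(ecol_val c ve).
Qed.

Lemma proper_ecolP c :
  reflect (forall x y z, adj x y -> adj x z -> y != z -> ecol c x y != ecol c x z)
          (proper c).
Proof.
apply: (iffP forallP) => [cP x y z xy xz yz | cP e].
  have [e ve] := adj_edge xy; have [f vf] := adj_edge xz.
  rewrite (ecol_val c ve) (ecol_val c vf).
  move/forallP/(_ f)/implyP: (cP e); apply; apply/andP; split.
    apply: contra_neq yz => ef.
    by have /set2_inj[[]|[-> ->]] : [set x; y] = [set x; z] by rewrite -ve -vf ef.
  by apply/set0Pn; exists x; rewrite ve vf !inE eqxx.
apply/forallP => f; apply/implyP => /andP[ef /set0Pn[x]].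
have to_x (g : edge_t adj) : x \in val g -> exists y, val g = [set x; y].
  have [u [v [_ ->]]] := edge_ends g.
  rewrite !inE => /orP[]/eqP->; first by exists v.
  by exists u; rewrite setUC.
rewrite inE => /andP[/to_x[y ve] /to_x[z vf]].
rewrite -(ecol_val c ve) -(ecol_val c vf).
apply: cP; [exact: edge_adj ve | exact: edge_adj vf |].
by apply: contra_neq ef => yz; apply: val_inj; rewrite /= ve vf yz.
Qed.

Lemma coloring_ext c d :
  (forall x y, adj x y -> ecol c x y = ecol d x y) -> c = d.
Proof.
move=> cd; apply/ffunP => e; have [x [y [xy ve]]] := edge_ends e.
by rewrite -(ecol_val c ve) -(ecol_val d ve) cd.
Qed.

(** An edge does not order its ends, so [pick] chooses an order; the choice is immaterial when [f]
    is symmetric on adjacent pairs. *)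
Definition coloring_of (f : V -> V -> 'I_n.+1) : coloring adj n.+1 :=
  [ffun e => if [pick p : V * V | val e == [set p.1; p.2]] is Some p
             then f p.1 p.2 else ord0].

Lemma ecol_coloring_of f x y :
  (forall u v, adj u v -> f u v = f v u) -> adj x y -> ecol (coloring_of f) x y = f x y.
Proof.
move=> fC xy; have [e ve] := adj_edge xy; rewrite (ecol_val _ ve) ffunE.
case: pickP => [[u v] /= /eqP | /(_ (x, y))]; last by rewrite ve eqxx.
by rewrite ve => /set2_inj[] [<- <-] //; rewrite (fC x y).
Qed.

Lemma swap_colL a b : swap_col a b a = b.
Proof. by rewrite /swap_col eqxx. Qed.

Lemma swap_colR a b : swap_col a b b = a.
Proof. by rewrite /swap_col eqxx; case: eqVneq => [->|]. Qed.

Lemma swap_col_id a b u : u != a -> u != b -> swap_col a b u = u.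
Proof. by rewrite /swap_col => /negPf-> /negPf->. Qed.

Lemma swap_colK a b : involutive (swap_col a b).
Proof.
move=> u; case: (eqVneq u a) => [->|ua]; first by rewrite swap_colL swap_colR.
case: (eqVneq u b) => [->|ub]; first by rewrite swap_colR swap_colL.
by rewrite !swap_col_id.
Qed.

Lemma swap_col_inj a b : injective (swap_col a b).
Proof. exact: inv_inj (swap_colK a b). Qed.

Lemma swap_col_same a u : swap_col a a u = u.
Proof. by rewrite /swap_col; case: eqVneq => [->|]. Qed.

Lemma swap_col_mem a b u :
  (swap_col a b u == a) || (swap_col a b u == b) = (u == a) || (u == b).
Proof.
case: (eqVneq u a) => [->|ua]; first by rewrite swap_colL eqxx orbT.
case: (eqVneq u b) => [->|ub]; first by rewrite swap_colR eqxx.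
by rewrite swap_col_id // (negPf ua) (negPf ub).
Qed.

(** Equivalently, [S] is a union of components of the spanning subgraph of edges coloured [a] or
    [b]. *)
Definition stable c a b S :=
  forall x y, adj x y -> (ecol c x y == a) || (ecol c x y == b) -> S x = S y.

Definition switch_on c a b S : coloring adj n.+1 :=
  [ffun e : edge_t adj =>
     if [exists y in val e, S y] then swap_col a b (c e) else c e].

Lemma eq_switch_on c a b S S' : S =1 S' -> switch_on c a b S = switch_on c a b S'.
Proof.
by move=> E; apply/ffunP => e; rewrite !ffunE; under eq_existsb do rewrite E.
Qed.

Lemma ecol_switch_on c a b S x y : stable c a b S -> adj x y ->
  ecol (switch_on c a b S) x y =
    if S x then swap_col a b (ecol c x y) else ecol c x y.
Proof.
move=> st xy; have [e ve] := adj_edge xy.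
rewrite (ecol_val _ ve) ffunE -(ecol_val c ve).
have -> : [exists z in val e, S z] = S x || S y.
  apply/existsP/orP => [[z]|].
    by rewrite ve !inE => /andP[/orP[]/eqP-> ->]; [left | right].
  by case=> [Sx|Sy]; [exists x | exists y]; rewrite ve !inE eqxx ?orbT.
have := st x y xy.
case: (boolP ((ecol c x y == a) || (ecol c x y == b))) => [_ /(_ isT) ->|].
  by rewrite orbb.
by rewrite negb_or => /andP[na nb] _; rewrite swap_col_id // !if_same.
Qed.

Lemma proper_switch_on c a b S :
  stable c a b S -> proper c -> proper (switch_on c a b S).
Proof.
move=> st /proper_ecolP cP; apply/proper_ecolP => x y z xy xz yz.
rewrite !ecol_switch_on //; case: ifP => _; last exact: cP.
by rewrite (inj_eq (@swap_col_inj a b)) cP.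
Qed.

Lemma kempe_rel_switch_on c a b S : stable c a b S ->
  kempe_rel (switch_on c a b S) a b =2 kempe_rel c a b.
Proof.
move=> st x y; rewrite !kempe_relE; case: (boolP (adj x y)) => //= xy.
by rewrite ecol_switch_on //; case: ifP => //; rewrite swap_col_mem.
Qed.

Lemma kempe_rel_connect_sym c a b : connect_sym (kempe_rel c a b).
Proof.
by apply: sym_connect_sym => x y; rewrite !kempe_relE adjC ecolC.
Qed.

Lemma stable_connect c a b x : stable c a b (connect (kempe_rel c a b) x).
Proof.
move=> u v uv cuv.
by apply: (same_connect1r (kempe_rel_connect_sym c a b)); rewrite kempe_relE uv cuv.
Qed.

Lemma stable_closed c a b S x y :
  stable c a b S -> connect (kempe_rel c a b) x y -> S x = S y.
Proof.
move=> st xy; apply: (@closed_connect _ (kempe_rel c a b) [in S]) xy.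
by move=> u v; rewrite kempe_relE => /andP[uv]; apply: st.
Qed.

Lemma kempe_switchE c a b x :
  kempe_switch c a b x = switch_on c a b (connect (kempe_rel c a b) x).
Proof.
apply/ffunP => e; rewrite !ffunE.
case: (boolP ((c e == a) || (c e == b))) => //=.
by rewrite negb_or => /andP[na nb]; rewrite swap_col_id // if_same.
Qed.

Lemma kempe_stepP c d : kempe_step c d ->
  exists a b S, stable c a b S /\ d = switch_on c a b S.
Proof.
move=> /existsP[a /existsP[b /existsP[x /andP[_ /eqP->]]]].
exists a, b, (connect (kempe_rel c a b) x).
by rewrite kempe_switchE; split; first exact: stable_connect.
Qed.

(** A switch exchanges [a] and [b] inside a chain and so leaves the two-coloured subgraph unchanged;
    repeating it on the same chain undoes it. *)
Lemma kempe_step_sym : symmetric (@kempe_step V adj n.+1).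
Proof.
suff H c d : kempe_step c d -> kempe_step d c by move=> c d; apply/idP/idP; apply: H.
move=> /existsP[a /existsP[b /existsP[x /andP[ab /eqP->]]]].
apply/existsP; exists a; apply/existsP; exists b; apply/existsP; exists x.
rewrite ab !kempe_switchE /=; set T := connect (kempe_rel c a b) x.
have st : stable c a b T := @stable_connect c a b x.
set d' := switch_on c a b T.
rewrite -(@eq_switch_on d' a b T); last first.
  by move=> y; apply: eq_connect => u v; rewrite kempe_rel_switch_on.
have st' : stable d' a b T.
  move=> u v uv; have := kempe_rel_switch_on st u v.
  by rewrite !kempe_relE uv /= => ->; apply: st.
apply/eqP/coloring_ext => u v uv; rewrite !ecol_switch_on //.
by case: (T u); rewrite ?swap_colK.
Qed.

Lemma kempe_equiv_sym : symmetric (@kempe_equiv V adj n.+1).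
Proof. exact: sym_connect_sym kempe_step_sym. Qed.

Lemma kempe_equiv_trans : transitive (@kempe_equiv V adj n.+1).
Proof. exact: connect_trans. Qed.

(* A set stable for the colours a, b is a disjoint union of Kempe chains, so they can
   be switched one at a time. *)
Lemma kempe_equiv_switch_on c a b S :
  stable c a b S -> kempe_equiv c (switch_on c a b S).
Proof.
(* A Kempe step requires distinct colours; for [a = b] the switch is the identity and no step is
   taken. *)
have [-> st|ab] := eqVneq a b.
  rewrite /kempe_equiv (_ : switch_on c b b S = c) ?connect0 //.
  by apply: coloring_ext => x y xy; rewrite ecol_switch_on // swap_col_same if_same.
have [m] := ubnP #|S|; elim: m => // m IH in c S * => leSm st.
case: (pickP S) => [x Sx|S0]; last first.
  rewrite /kempe_equiv (_ : switch_on c a b S = c) ?connect0 //.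
  by apply: coloring_ext => x y xy; rewrite ecol_switch_on // S0.
set T := connect (kempe_rel c a b) x.
have stT : stable c a b T := @stable_connect c a b x.
have sTS u : T u -> S u by move=> /(stable_closed st) <-.
pose c1 := switch_on c a b T; pose S1 u := S u && ~~ T u.
have cc1 : kempe_equiv c c1.
  apply: connect1; apply/existsP; exists a; apply/existsP; exists b.
  by apply/existsP; exists x; rewrite ab kempe_switchE /=.
have st1 : stable c1 a b S1.
  move=> u v uv; have := kempe_rel_switch_on stT u v.
  by rewrite !kempe_relE uv /= => -> cuv; rewrite /S1 (st u v) ?(stT u v).
apply: (kempe_equiv_trans cc1).
have -> : switch_on c a b S = switch_on c1 a b S1.
  apply: coloring_ext => u v uv; rewrite !ecol_switch_on // /S1.
  by case: (boolP (T u)) => [/sTS ->|]; rewrite ?andbF ?andbT.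
apply: IH st1; rewrite ltnS in leSm; apply: leq_trans leSm.
apply: proper_card; apply/properP; split.
  by apply/subsetP => u /andP[].
by exists x => //; rewrite unfold_in /S1 /T connect0 andbF.
Qed.

Lemma kempe_move c a b S : proper c -> stable c a b S ->
  exists d, [/\ proper d, kempe_equiv c d & forall x y, adj x y ->
    ecol d x y = if S x then swap_col a b (ecol c x y) else ecol c x y].
Proof.
move=> cP st; exists (switch_on c a b S); split.
- exact: proper_switch_on.
- exact: kempe_equiv_switch_on.
- by move=> x y; apply: ecol_switch_on.
Qed.

(** The set of all vertices is stable for any two colours. A first global switch brings [p] to [p'],
    a second brings the image of [q] to [q']; the latter fixes [p'], which differs from both
    colours. *)
Lemma kempe_recolor c p q (p' q' : 'I_n.+1) : proper c -> p != q -> p' != q' ->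
  exists d (s : 'I_n.+1 -> 'I_n.+1), [/\ proper d, kempe_equiv c d,
    s p = p', s q = q' &
    forall x y, adj x y -> ecol d x y = s (ecol c x y)].
Proof.
move=> cP pq pq'.
have [d [dP cd dE]] := @kempe_move c p p' predT cP (fun _ _ _ _ => erefl).
have [f [fP df fE]] := @kempe_move d (swap_col p p' q) q' predT dP (fun _ _ _ _ => erefl).
exists f, (fun u => swap_col (swap_col p p' q) q' (swap_col p p' u)).
split=> //; first exact: kempe_equiv_trans cd df.
- rewrite swap_colL swap_col_id //.
  by apply: contraNneq pq => E; apply/eqP/(@swap_col_inj p p'); rewrite swap_colL.
- by rewrite swap_colL.
- by move=> x y xy; rewrite fE // dE.
Qed.

Lemma Kprime_eq1 c0 : proper c0 -> (forall c, proper c -> kempe_equiv c0 c) ->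
  Kprime adj n.+1 = 1.
Proof.
move=> c0P equiv0; rewrite /Kprime (_ : imset _ _ = [set [set d | proper d]]) ?cards1 //.
have class_all c : proper c ->
    [set d | proper d && kempe_equiv c d] = [set d | proper d].
  move=> cP; apply/setP => d; rewrite !inE; case: (boolP (proper d)) => //= dP.
  by apply: (@kempe_equiv_trans c0); rewrite ?equiv0 // kempe_equiv_sym equiv0.
apply/setP => X; rewrite inE; apply/imsetP/eqP => [[c]|->].
  by rewrite inE => cP ->; apply: class_all.
by exists c0; rewrite ?class_all ?inE.
Qed.

Lemma Kprime_eq2 c1 c2 : proper c1 -> proper c2 -> ~~ kempe_equiv c1 c2 ->
  (forall c, proper c -> kempe_equiv c1 c || kempe_equiv c2 c) ->
  Kprime adj n.+1 = 2.
Proof.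
move=> c1P c2P n12 equiv12.
pose K c := [set d : coloring adj n.+1 | proper d && kempe_equiv c d].
have Keq c d : kempe_equiv c d -> K c = K d.
  move=> cd; apply/setP => f; rewrite !inE; case: (proper f) => //=.
  apply/idP/idP; apply: kempe_equiv_trans => //; by rewrite kempe_equiv_sym.
rewrite /Kprime (_ : imset _ _ = [set K c1; K c2]) ?cards2; last first.
  apply/setP => X; rewrite !inE; apply/imsetP/orP => [[c]|].
    rewrite inE => /equiv12/orP[] cE ->; [left | right]; apply/eqP/esym; exact: Keq.
  by case=> /eqP->; [exists c1 | exists c2]; rewrite ?inE.
suff -> : K c1 != K c2 by [].
apply: contraNneq n12 => E; have : c2 \in K c2 by rewrite inE c2P /kempe_equiv connect0.
by rewrite -E inE => /andP[].
Qed.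

End KempeSwitches.

(** * Cyclic ladders *)

Definition col0 : 'I_3 := @Ordinal 3 0 isT.
Definition col1 : 'I_3 := @Ordinal 3 1 isT.
Definition col2 : 'I_3 := @Ordinal 3 2 isT.

(** For [a = b] this still gives a colour other than [a], and it is used that way too. *)
Definition third (a b : 'I_3) : 'I_3 :=
  if (col0 != a) && (col0 != b) then col0
  else if (col1 != a) && (col1 != b) then col1 else col2.

Lemma third_neq a b : third a b != a /\ third a b != b.
Proof.
by move: a b => [[|[|[|//]]] ?] [[|[|[|//]]] ?].
Qed.

Lemma third_unique (a b x y : 'I_3) :
  a != b -> x != a -> x != b -> y != a -> y != b -> x = y.
Proof.
move: (ltn_ord a) (ltn_ord b) (ltn_ord x) (ltn_ord y).
by rewrite -!val_eqE /= => *; apply: val_inj => /=; lia.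
Qed.

(* [nx] and [px] move forwards and backwards along the rails, [mt] crosses the rung, and
   [pos] numbers the rungs cyclically; the rails may close up straight (prism) or crossed
   (Moebius ladder). *)
Section Ladder.

Variables (V : finType) (adj : rel V) (k : nat).
Variables (nx px mt : V -> V) (pos : V -> nat) (at_ : nat -> V).

Hypothesis k_gt1 : 1 < k.
Hypothesis adjE : forall x y, adj x y = [|| y == nx x, x == nx y | y == mt x].
Hypothesis nxK : cancel nx px.
Hypothesis pxK : cancel px nx.
Hypothesis mtK : involutive mt.
Hypothesis nx_mt : forall x, nx (mt x) = mt (nx x).
Hypothesis nx_neq_px : forall x, nx x != px x.
Hypothesis nx_neq_mt : forall x, nx x != mt x.
Hypothesis pos_lt : forall x, pos x < k.
Hypothesis pos_nx : forall x, pos (nx x) = (pos x).+1 %% k.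
Hypothesis pos_mt : forall x, pos (mt x) = pos x.
Hypothesis pos_at : forall i, i < k -> pos (at_ i) = i.
Hypothesis pos_inj : forall x y, pos x = pos y -> y = x \/ y = mt x.

Implicit Types (c d : coloring adj 3) (x y : V) (al : nat -> 'I_3).

Let adjC : symmetric adj.
Proof.
move=> x y; rewrite !adjE orbCA (_ : (y == mt x) = (x == mt y)) //.
by rewrite eq_sym -(inj_eq (inv_inj mtK)) mtK.
Qed.

Lemma adj_nx x : adj x (nx x).
Proof. by rewrite adjE eqxx. Qed.

Lemma adj_px x : adj x (px x).
Proof. by rewrite adjE pxK eqxx orbT. Qed.

Lemma adj_mt x : adj x (mt x).
Proof. by rewrite adjE eqxx !orbT. Qed.

Lemma adjP x y : adj x y -> [\/ y = nx x, y = px x | y = mt x].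
Proof.
rewrite adjE => /or3P[]/eqP->; rewrite ?nxK;
  by [constructor 1 | constructor 2 | constructor 3].
Qed.

Lemma px_neq_mt x : px x != mt x.
Proof.
apply: contraNneq (nx_neq_mt (mt x)) => E.
by rewrite mtK -E pxK.
Qed.

Definition rail c x := ecol c x (nx x).
Definition rung c x := ecol c x (mt x).
Definition flat c := [forall x, rail c (mt x) == rail c x].

Lemma rung_mt c x : rung c (mt x) = rung c x.
Proof. by rewrite /rung mtK ecolC. Qed.

Lemma ecol_px c x : ecol c x (px x) = rail c (px x).
Proof. by rewrite /rail pxK ecolC. Qed.

Lemma px_mt x : px (mt x) = mt (px x).
Proof. by rewrite -{1}[x]pxK -nx_mt nxK. Qed.

(** * Propagation of rail colours across one rung *)

Section Proper.

Variables (c : coloring adj 3) (cP : proper c).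

Lemma rail_nx_neq x : rail c (nx x) != rail c x.
Proof.
rewrite -{2}[x]nxK -ecol_px; apply: (proper_ecolP adjC c cP).
- exact: adj_nx.
- exact: adj_px.
- exact: nx_neq_px.
Qed.

Lemma rung_neq x : rung c x != rail c x.
Proof.
apply: (proper_ecolP adjC c cP); [exact: adj_mt | exact: adj_nx |].
by rewrite eq_sym nx_neq_mt.
Qed.

Lemma rung_nx_neq x : rung c (nx x) != rail c x.
Proof.
rewrite -{2}[x]nxK -ecol_px; apply: (proper_ecolP adjC c cP).
- exact: adj_mt.
- exact: adj_px.
- by rewrite eq_sym px_neq_mt.
Qed.

Lemma rail_px_neq x : rail c x != rail c (px x).
Proof. by have := rail_nx_neq (px x); rewrite pxK. Qed.

Lemma rung_px_neq x : rung c x != rail c (px x).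
Proof. by have := rung_nx_neq (px x); rewrite pxK. Qed.

(** Both outgoing rails avoid the rung colour and the common colour of the incoming rails, which
    leaves a single colour. *)
Lemma rail_nx_flat x :
  rail c (mt x) = rail c x -> rail c (mt (nx x)) = rail c (nx x).
Proof.
move=> E; apply: (@third_unique (rung c (nx x)) (rail c x)).
- exact: rung_nx_neq.
- by rewrite eq_sym -rung_mt rung_neq.
- by rewrite -nx_mt -E rail_nx_neq.
- by rewrite eq_sym rung_neq.
- exact: rail_nx_neq.
Qed.

(** The rung at [nx x] avoids both incoming colours, so the outgoing rail, avoiding the rung and its
    own incoming rail, takes the colour of the opposite incoming rail. *)
Lemma rail_nx_twisted x :
  rail c (mt x) != rail c x -> rail c (nx x) = rail c (mt x).
Proof.
move=> E; apply: (@third_unique (rung c (nx x)) (rail c x)) => //.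
- exact: rung_nx_neq.
- by rewrite eq_sym rung_neq.
- exact: rail_nx_neq.
- by rewrite eq_sym -rung_mt -nx_mt rung_nx_neq.
Qed.

End Proper.

Lemma pos_iter n x : pos (iter n nx x) = (pos x + n) %% k.
Proof.
elim: n => [|n IH] /=; first by rewrite addn0 modn_small.
by rewrite pos_nx IH -addn1 modnDml addn1 addnS.
Qed.

(** Walking [k - pos x0 + pos x] steps forward from [x0] reaches the position of [x]; at most one
    rung then remains to be crossed. *)
Lemma ladder_ind (Q : V -> Prop) x0 :
  Q x0 -> (forall x, Q x -> Q (nx x)) -> (forall x, Q x -> Q (mt x)) ->
  forall x, Q x.
Proof.
move=> Q0 Qnx Qmt x.
have Qn n : Q (iter n nx x0) by elim: n => //= n; apply: Qnx.
have /pos_inj[->|->] : pos (iter (k - pos x0 + pos x) nx x0) = pos x; last 2 first.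
- exact: Qn.
- exact/Qmt/Qn.
rewrite pos_iter addnA subnKC; last exact/ltnW/pos_lt.
by rewrite modnDl modn_small.
Qed.

(** Agreement of the rails at a single position would spread around the whole ladder. *)
Lemma flatVtwisted c : proper c -> ~~ flat c -> forall x, rail c (mt x) != rail c x.
Proof.
move=> cP tw x0; apply: contraNN tw.
move=> /eqP E0; apply/forallP => x; apply/eqP; move: x.
apply: (ladder_ind E0) => x E; first exact: rail_nx_flat.
by rewrite mtK E.
Qed.

(** The two rails at a vertex have different colours, so they force the colour of the rung. *)
Lemma coloring_rail_ext c d :
  proper c -> proper d -> (forall x, rail c x = rail d x) -> c = d.
Proof.
move=> cP dP E; apply: coloring_ext => x y /adjP[]->.
- exact: E.
- by rewrite !ecol_px E.
apply: (@third_unique (rail c x) (rail c (px x))).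
- exact: rail_px_neq.
- exact: rung_neq.
- exact: rung_px_neq.
- by rewrite E rung_neq.
- by rewrite E rung_px_neq.
Qed.

Lemma ladder_coloring (rho g : V -> 'I_3) :
  (forall x, rho (nx x) != rho x) -> (forall x, g (mt x) = g x) ->
  (forall x, g x != rho x) -> (forall x, g (nx x) != rho x) ->
  exists2 c : coloring adj 3, proper c & forall x, rail c x = rho x.
Proof.
move=> rhoP g_mt g_rho g_nx.
pose f x y := if y == mt x then g x else if y == nx x then rho x else rho y.
have f_mt x : f x (mt x) = g x by rewrite /f eqxx.
have f_nx x : f x (nx x) = rho x by rewrite /f (negPf (nx_neq_mt x)) eqxx.
have f_px x : f x (px x) = rho (px x).
  by rewrite /f (negPf (px_neq_mt x)) eq_sym (negPf (nx_neq_px x)).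
have fC x y : adj x y -> f x y = f y x.
  case/adjP=> ->; rewrite ?f_mt ?f_nx ?f_px.
  - by have := f_px (nx x); rewrite nxK => ->.
  - by have := f_nx (px x); rewrite pxK => ->.
  - by have := f_mt (mt x); rewrite mtK => ->; rewrite g_mt.
have cE x y : adj x y -> ecol (coloring_of adj f) x y = f x y.
  exact: ecol_coloring_of.
exists (coloring_of adj f); last by move=> x; rewrite /rail cE ?adj_nx.
have rho_px x : rho x != rho (px x) by have := rhoP (px x); rewrite pxK.
have g_px x : g x != rho (px x) by have := g_nx (px x); rewrite pxK.
apply/(proper_ecolP adjC) => x y z xy xz; rewrite !cE //.
by case/adjP: xy => ->; case/adjP: xz => ->; rewrite ?eqxx // ?f_mt ?f_nx ?f_px => _;
  rewrite // eq_sym.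
Qed.

(** * Flat colourings as cyclic words *)

Definition tracks c al := forall x, rail c x = al (pos x).

Lemma flat_tracks c : flat c -> tracks c (fun i => rail c (at_ i)).
Proof.
move=> /forallP fl x.
have /pos_inj[->|->] // : pos x = pos (at_ (pos x)) by rewrite pos_at.
by rewrite (eqP (fl _)).
Qed.

Lemma tracks_neq c al i : proper c -> tracks c al -> i < k -> al (i.+1 %% k) != al i.
Proof.
move=> cP ct ik; rewrite -{1}(pos_at ik) -pos_nx -ct.
by rewrite -{2}(pos_at ik) -ct rail_nx_neq.
Qed.

(* Two rails of a flat colouring at the same position carry the same colour, so Kempe
   switches of flat colourings are switches on the cyclic word [al] of rail colours. *)
Lemma ladder_move c al (a b : 'I_3) (P : pred nat) :
  proper c -> tracks c al ->
  (forall i, i < k -> al i \in [:: a; b] -> al (i.+1 %% k) \in [:: a; b] ->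
     P i = P (i.+1 %% k)) ->
  exists d, [/\ proper d, kempe_equiv c d &
    tracks d (fun i => if P i then swap_col a b (al i) else al i)].
Proof.
move=> cP ct Pcl.
(* [P] selects rails, while a switch needs vertices: a vertex follows its outgoing rail if that is
   coloured [a] or [b], and its incoming rail otherwise. *)
pose S x := if al (pos x) \in [:: a; b] then P (pos x) else P (pos (px x)).
have S_nx x : al (pos x) \in [:: a; b] -> S (nx x) = P (pos x).
  move=> ax; rewrite /S pos_nx nxK; case: ifP => // ax1.
  by rewrite -Pcl.
have [|d [dP cd dE]] := @kempe_move _ _ _ adjC c a b S cP.
  move=> x y xy; rewrite -(mem_seq2 _ a b).
  case/adjP: xy => ->.
  - by rewrite -/(rail c x) ct => ax; rewrite S_nx // /S ax.
  - rewrite ecol_px ct => ax; rewrite [RHS]/S ax.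
    by rewrite -{1}[x]pxK S_nx.
  - by rewrite /S px_mt !pos_mt.
exists d; split=> // x; rewrite /rail dE ?adj_nx // -/(rail c x) ct /S.
case: (boolP (al (pos x) \in [:: a; b])) => // ax.
have E : swap_col a b (al (pos x)) = al (pos x).
  by move: ax; rewrite !inE => /norP[na nb]; apply: swap_col_id.
by rewrite E !if_same.
Qed.

(** Neither neighbour of position [j] is coloured [al j] or [u], so no chain of these two colours
    leaves the rails at [j] along the ladder. *)
Lemma tracks_recolor c al j w u :
  proper c -> tracks c al -> 0 < j -> j.+1 < k -> al j.-1 = w -> al j.+1 = w ->
  u != w -> exists d, [/\ proper d, kempe_equiv c d &
    tracks d (fun i => if i == j then u else al i)].
Proof.
move=> cP ct j0 jk wl wr uw.
have aw : al j != w.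
  have := @tracks_neq c al j.-1 cP ct; rewrite wl modn_small; last by lia.
  by rewrite prednK //; apply; lia.
have wN : w \in [:: al j; u] = false.
  by rewrite !inE ![w == _]eq_sym (negPf aw) (negPf uw).
have [i ik ai ai1|d [dP cd dt]] := @ladder_move c al (al j) u (pred1 j) cP ct.
  rewrite /=; case: eqVneq ai ai1 => [->|ij ai ai1].
    by rewrite modn_small // wr wN.
  case: eqVneq ai1 ai => // E ai1.
  have : i.+1 = j.
    move: E; case: (ltnP i.+1 k) => ik1; first by rewrite modn_small.
    by rewrite (_ : i.+1 = k) ?modnn; lia.
  by move=> E'; rewrite (_ : i = j.-1) ?wl ?wN //; lia.
exists d; split=> // x; rewrite dt /=; case: eqVneq => // ->.
by rewrite swap_colL.
Qed.

(** The letters at [j] and [j.+1] are the two colours other than [w], so the surrounding letters [w]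
    cut their chains off from the rest of the word. *)
Lemma tracks_flip c al j w :
  proper c -> tracks c al -> 0 < j -> j.+2 < k -> al j.-1 = w -> al j.+2 = w ->
  exists d, [/\ proper d, kempe_equiv c d &
    tracks d (fun i => if i == j then al j.+1 else if i == j.+1 then al j else al i)].
Proof.
move=> cP ct j0 jk wl wr.
have aw : al j != w.
  have := @tracks_neq c al j.-1 cP ct; rewrite wl modn_small; last by lia.
  by rewrite prednK //; apply; lia.
have bw : al j.+1 != w.
  have := @tracks_neq c al j.+1 cP ct; rewrite modn_small // wr eq_sym.
  by apply; lia.
have wN : w \in [:: al j; al j.+1] = false.
  by rewrite !inE ![w == _]eq_sym (negPf aw) (negPf bw).
pose P i := (i == j) || (i == j.+1).
have [i ik ai ai1|d [dP cd dt]] := @ladder_move c al (al j) (al j.+1) P cP ct.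
  rewrite /P; case: (ltnP i.+1 k) ai1 => ik1; last first.
    by move=> _; rewrite (_ : i.+1 = k) ?modnn; lia.
  rewrite modn_small // => ai1.
  case: (eqVneq i j.-1) ai => [->|i1 _]; first by rewrite wl wN.
  case: (eqVneq i j.+1) ai1 => [->|i2 _]; first by rewrite wr wN.
  by lia.
exists d; split=> // x; rewrite dt /P /=.
case: eqVneq => [->|_] /=; first by rewrite swap_colL.
by case: eqVneq => [->|_] //=; rewrite swap_colR.
Qed.

(** The single final 0 lets the alternating word close up for either parity of [k]. *)
Definition normal_rail i : 'I_3 :=
  if i == k.-1 then col0 else if odd i then col2 else col1.

Lemma tracks_normal c : proper c -> flat c ->
  exists d, [/\ proper d, kempe_equiv c d & tracks d normal_rail].
Proof.
move=> cP /flat_tracks ct.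
suff [d [al [dP cd dt al_last al_lt]]] : exists d al, [/\ proper d, kempe_equiv c d,
    tracks d al, al k.-1 = col0 & forall i, i < k.-1 -> al i = normal_rail i].
  exists d; split=> // x; rewrite dt; have := pos_lt x.
  case: (ltnP (pos x) k.-1) => [/al_lt //|? ?].
  by rewrite (_ : pos x = k.-1) ?al_last /normal_rail ?eqxx //; lia.
have trans := @kempe_equiv_trans V adj 2.
have : k.-1 < k by lia.
(* The induction is on the length of the prefix agreeing with [normal_rail]; the occurrence left out
   is the position of the last letter, kept at [col0]. *)
elim: {-2}k.-1 => [_|m IH mk].
  have [//|d [dP cd dt]] := @ladder_move c _ (rail c (at_ k.-1)) col0 predT cP ct.
  exists d, (fun i => swap_col (rail c (at_ k.-1)) col0 (rail c (at_ i))).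
  by split=> //; apply: swap_colL.
have {IH}[|d [al [dP cd dt al_last al_lt]]] := IH; first by lia.
have al_neq i : i.+1 < k -> al i.+1 != al i.
  by move=> ik; have := @tracks_neq d al i dP dt; rewrite modn_small //; apply; lia.
case: (posnP m) => [m0|m_gt0].
  (* Cyclically the last letter 0 precedes the first, which is thus 1 or 2; a global switch of 1 and
     2 keeps the final 0. *)
  subst m; have := @tracks_neq d al k.-1 dP dt.
  rewrite prednK ?modnn ?al_last //; last by lia.
  move=> /(_ (leqnn _)) al0.
  have t0 : normal_rail 0 = col1 by rewrite /normal_rail ifF //; lia.
  have [E|E] := eqVneq (al 0) col1.
    by exists d, al; split=> // -[|//] _; rewrite E t0.
  have [//|f [fP df ft]] := @ladder_move d al col1 col2 predT dP dt.
  exists f, (fun i => swap_col col1 col2 (al i)); split; rewrite ?al_last //.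
    exact: trans cd df.
  move=> [|//] _ /=; rewrite t0 (_ : al 0 = col2) //.
  by apply: (@third_unique col0 col1).
have tm : normal_rail m = if odd m then col2 else col1 by rewrite /normal_rail ifF //; lia.
have tm1 : al m.-1 = if odd m then col1 else col2.
  rewrite al_lt; last by lia.
  by rewrite /normal_rail ifF; [case: m m_gt0 {tm al_lt mk} => //= m _; case: odd | lia].
have al_m := al_neq m.-1; rewrite prednK // in al_m.
have {}al_m : al m != al m.-1 by apply: al_m; lia.
set u := normal_rail m in tm; set w := al m.-1 in tm1 al_m.
have uw : u != w by rewrite tm tm1; case: odd.
have u0 : u != col0 by rewrite tm; case: odd.
have w0 : w != col0 by rewrite tm1; case: odd.
have [Em|Em] := eqVneq (al m) u.
  exists d, al; split=> // i; rewrite ltnS leq_eqVlt => /orP[/eqP->|/al_lt//].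
  by rewrite Em.
have Em0 : al m = col0 by apply: (third_unique uw) => //; rewrite eq_sym.
have extend f al' : proper f -> kempe_equiv d f -> tracks f al' -> al' k.-1 = col0 ->
    al' m = u -> (forall i, i < m -> al' i = al i) ->
    exists d al, [/\ proper d, kempe_equiv c d,
    tracks d al, al k.-1 = col0 & forall i, i < m.+1 -> al i = normal_rail i].
  move=> fP df ft fl fm flt; exists f, al'; split=> //; first exact: trans cd df.
  by move=> i; rewrite ltnS leq_eqVlt => /orP[/eqP->//|im]; rewrite flt // al_lt.
(* The word reads .. w 0 at positions m-1, m; the 0 must become u.  Depending on what
   follows: w 0 w -> w u w;  w 0 u w -> w u 0 w;  w 0 u 0 -> w 0 w 0 -> w u w 0. *)
have m1k : m.+2 < k.
  have : m.+1 != k.-1 by apply: contraTneq (al_neq m mk) => ->; rewrite al_last Em0.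
  by lia.
have al_m1 := al_neq m mk.
have [E1|E1] := eqVneq (al m.+1) w.
  have [f [fP df ft]] := tracks_recolor dP dt m_gt0 mk erefl E1 uw.
  apply: extend fP df ft _ _ _; rewrite ?eqxx //.
    by rewrite ifF //; lia.
  by move=> i im; rewrite ifF //; lia.
have {}E1 : al m.+1 = u.
  by apply: (@third_unique col0 w) => //; [rewrite eq_sym | rewrite -Em0].
have [E2|E2] := eqVneq (al m.+2) w.
  have m2k : m.+3 < k.
    have : m.+2 != k.-1 by apply: contraNneq w0 => E; rewrite -E2 E al_last.
    by lia.
  have [f [fP df ft]] := tracks_flip dP dt m_gt0 m1k erefl E2.
  apply: extend fP df ft _ _ _; rewrite ?eqxx //.
    by rewrite !ifF //; lia.
  by move=> i im; rewrite !ifF //; lia.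
have {}E2 : al m.+2 = col0.
  apply: (third_unique uw) => //; rewrite 1?[col0 == _]eq_sym //.
  by rewrite -E1 al_neq.
have [f [fP df ft]] := @tracks_recolor d al m.+1 col0 w dP dt isT m1k Em0 E2 w0.
have [||g [gP fg gt]] := @tracks_recolor f _ m w u fP ft m_gt0 mk _ _ uw.
- by rewrite /= ifF //; lia.
- by rewrite /= eqxx.
apply: extend gP (trans _ _ _ df fg) gt _ _ _; rewrite ?eqxx //=.
  by rewrite !ifF //; lia.
by move=> i im; rewrite !ifF //; lia.
Qed.

Lemma flat_equiv c d : proper c -> proper d -> flat c -> flat d -> kempe_equiv c d.
Proof.
move=> cP dP /(tracks_normal cP)[c' [c'P cc' c't]] /(tracks_normal dP)[d' [d'P dd' d't]].
apply: (kempe_equiv_trans cc'); rewrite (kempe_equiv_sym adjC).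
by rewrite (@coloring_rail_ext c' d') // => x; rewrite c't d't.
Qed.

Lemma exists_flat : exists2 c : coloring adj 3, proper c & flat c.
Proof.
pose rho x := normal_rail (pos x).
pose g x := third (rho x) (rho (px x)).
have rho_nx x : rho (nx x) != rho x.
  rewrite /rho pos_nx /normal_rail; have := pos_lt x; set i := pos x => ik.
  case: (ltnP i.+1 k) => ik1.
    rewrite modn_small // [X in _ != X]ifF; last by lia.
    by case: ifP => _ /=; case: (odd i).
  rewrite (_ : i.+1 = k) ?modnn; last by lia.
  rewrite (_ : i = k.-1) ?eqxx; last by lia.
  by rewrite ifF //; lia.
have [x|x|x|x|c cP cE] := @ladder_coloring rho g.
- exact: rho_nx.
- by rewrite /g /rho px_mt !pos_mt.
- by case: (third_neq (rho x) (rho (px x))).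
- by rewrite /g nxK; case: (third_neq (rho (nx x)) (rho x)).
exists c => //; apply/forallP => x; by rewrite !cE /rho pos_mt.
Qed.

(** [s] marks one of two disjoint long rails. In a twisted colouring all rails have colours [a] or
    [b] and no rung does, so [s] is stable, and switching that side alone makes opposite rails
    agree. *)
Lemma untwist_sides (s : pred V) c :
  (forall x, s (nx x) = s x) -> (forall x, s (mt x) = ~~ s x) ->
  proper c -> exists d, [/\ proper d, kempe_equiv c d & flat d].
Proof.
move=> s_nx s_mt cP.
case: (boolP (flat c)) => [fl|/(flatVtwisted cP) tw].
  by exists c; split; rewrite // /kempe_equiv connect0.
pose a := rail c (at_ 0); pose b := rail c (mt (at_ 0)).
have Q : forall x, (rail c x = a /\ rail c (mt x) = b) \/
                   (rail c x = b /\ rail c (mt x) = a).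
  apply: (@ladder_ind _ (at_ 0)) => [|x|x]; first by left.
    rewrite -nx_mt !rail_nx_twisted ?mtK ?tw //; last by rewrite eq_sym tw.
    by case=> [[-> ->]|[-> ->]]; [right | left].
  by rewrite mtK => -[[-> ->]|[-> ->]]; [right | left].
have [|d [dP cd dE]] := @kempe_move _ _ _ adjC c a b s cP.
  move=> x y /adjP[]->; rewrite ?s_nx //; first by rewrite -(s_nx (px x)) pxK.
  have := rung_neq cP x; have := rung_neq cP (mt x); rewrite rung_mt -/(rung c x).
  by case: (Q x) => -[-> ->] /negPf-> /negPf->.
exists d; split=> //; apply/forallP => x.
rewrite /rail !dE ?adj_nx // -!/(rail c _) s_mt.
by case: (s x); case: (Q x) => -[-> ->]; rewrite /= ?swap_colL ?swap_colR.
Qed.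

Lemma Kprime_untwisted (s : pred V) :
  (forall x, s (nx x) = s x) -> (forall x, s (mt x) = ~~ s x) -> Kprime adj 3 = 1.
Proof.
move=> s_nx s_mt; have [c0 c0P fl0] := exists_flat.
apply: (Kprime_eq1 adjC c0P) => c cP.
have [d [dP cd fl]] := untwist_sides s_nx s_mt cP.
by apply: (kempe_equiv_trans (flat_equiv c0P dP fl0 fl)); rewrite kempe_equiv_sym.
Qed.

(** * Ladders whose rails close up crossed *)

Section Moebius.

Hypothesis iter_nx : forall x, iter k nx x = mt x.

Lemma rail_iter2 c n x : proper c -> ~~ flat c -> rail c (iter n.*2 nx x) = rail c x.
Proof.
move=> cP /(flatVtwisted cP) tw; elim: n => // n <-.
have step y : rail c (nx (nx y)) = rail c y.
  by rewrite rail_nx_twisted // -nx_mt rail_nx_twisted ?mtK // eq_sym.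
by rewrite doubleS /= step.
Qed.

(** Twisted rails have period two along [nx], so an even number [k] of steps would give [x] and
    [mt x] the same rail colour. *)
Lemma moebius_even_flat c : ~~ odd k -> proper c -> flat c.
Proof.
move=> ek cP; case: (boolP (flat c)) => // tw; have := flatVtwisted cP tw (at_ 0).
by rewrite -iter_nx -(even_halfK ek) rail_iter2 // eqxx.
Qed.

Lemma moebius_flat_step c d : odd k -> proper c -> flat c -> kempe_step c d ->
  proper d && flat d.
Proof.
move=> ok cP fl /(kempe_stepP adjC)[a [b [S [st ->]]]].
have dP := proper_switch_on adjC st cP; rewrite dP /=.
(* A rail pair of the third colour is untouched by the switch; it still agrees, which excludes a
   twisted result. *)
case: (boolP [exists x, (rail c x != a) && (rail c x != b)]) => [/existsP[x /andP[xa xb]]|].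
  apply: contraT => /(flatVtwisted dP)/(_ x).
  rewrite /rail !(ecol_switch_on st) ?adj_nx // -!/(rail c _).
  by rewrite (eqP (forallP fl x)) swap_col_id // !if_same eqxx.
(* Otherwise the rails alternate between [a] and [b] along [nx], so [k] steps, an odd number, would
   change the colour from [x] to [mt x], against flatness. *)
rewrite negb_exists => /forallP ab.
have ab' x : (rail c x == a) || (rail c x == b) by rewrite -[_ || _]negbK negb_or ab.
have sw x : rail c (nx x) = swap_col a b (rail c x).
  have := rail_nx_neq cP x; have := ab' (nx x).
  by case/orP: (ab' x) => /eqP->; rewrite ?swap_colL ?swap_colR => /orP[]/eqP-> //;
    rewrite eqxx.
have sw2 n x : rail c (iter n.*2 nx x) = rail c x.
  by elim: n => // n <-; rewrite doubleS /= !sw swap_colK.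
have := rail_nx_neq cP (iter k./2.*2 nx (at_ 0)).
have kE : k./2.*2.+1 = k by rewrite -[RHS]odd_double_half ok.
by rewrite -iterS kE iter_nx sw2 (eqP (forallP fl _)) eqxx.
Qed.

(** A permutation of colours gives the rails at [at_ 0] the colours 0 and 1; twisted propagation
    then determines all other rails. *)
Lemma twisted_equiv c d :
  proper c -> proper d -> ~~ flat c -> ~~ flat d -> kempe_equiv c d.
Proof.
suff norm c0 : proper c0 -> ~~ flat c0 -> exists d0, [/\ proper d0, kempe_equiv c0 d0,
    ~~ flat d0 & rail d0 (at_ 0) = col0 /\ rail d0 (mt (at_ 0)) = col1].
  move=> cP dP /(norm c cP)[c' [c'P cc' ctw [c0 c1]]].
  move=> /(norm d dP)[d' [d'P dd' dtw [d0 d1]]].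
  apply: (kempe_equiv_trans cc'); rewrite (kempe_equiv_sym adjC).
  suff E : forall x, rail c' x = rail d' x /\ rail c' (mt x) = rail d' (mt x).
    by rewrite (@coloring_rail_ext c' d') // => x; case: (E x).
  have {}ctw := flatVtwisted c'P ctw; have {}dtw := flatVtwisted d'P dtw.
  apply: (@ladder_ind _ (at_ 0)) => [|x|x]; first by rewrite c0 c1 d0 d1.
    rewrite -nx_mt !rail_nx_twisted ?mtK //; first (by case=> -> ->);
      by rewrite eq_sym.
  by rewrite mtK => -[-> ->].
move=> cP /[dup] tw /(flatVtwisted cP) tw'.
have [||d0 [s [dP cd s0 s1 dE]]] :=
  @kempe_recolor _ _ _ adjC c0 (rail c0 (at_ 0)) (rail c0 (mt (at_ 0))) col0 col1 cP.
- by rewrite eq_sym tw'.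
- by [].
have rE x : rail d0 x = s (rail c0 x) by rewrite /rail dE ?adj_nx.
exists d0; split; rewrite ?rE //.
by rewrite negb_forall; apply/existsP; exists (at_ 0); rewrite !rE s0 s1.
Qed.

Lemma exists_twisted (s : pred V) : odd k -> (forall x, s (nx x) = ~~ s x) ->
  exists2 c : coloring adj 3, proper c & ~~ flat c.
Proof.
move=> ok s_nx; have s_mt x : s (mt x) = ~~ s x.
  have iter_s n : s (iter n nx x) = s x (+) odd n.
    by elim: n => [|n IH] /=; rewrite ?addbF // s_nx IH addbN.
  by rewrite -iter_nx iter_s ok addbT.
have [x||||c cP cE] := @ladder_coloring (fun x => if s x then col1 else col0) (fun=> col2).
- by rewrite s_nx; case: (s x).
- by [].
- by move=> x; case: (s x).
- by move=> x; case: (s x).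
exists c => //; rewrite negb_forall; apply/existsP; exists (at_ 0).
by rewrite !cE s_mt; case: (s _).
Qed.

Lemma Kprime_moebius (s : pred V) : (forall x, s (nx x) = ~~ s x) ->
  Kprime adj 3 = if odd k then 2 else 1.
Proof.
move=> s_nx; have [c1 c1P fl1] := exists_flat.
case: ifPn => ok; last first.
  apply: (Kprime_eq1 adjC c1P) => c cP.
  exact: flat_equiv c1P cP fl1 (moebius_even_flat ok cP).
have [c2 c2P tw2] := exists_twisted ok s_nx.
apply: (Kprime_eq2 adjC c1P c2P) => [|c cP].
  pose flat_proper := [pred c : coloring adj 3 | proper c && flat c].
  (* Since steps are symmetric, it suffices that a step out of a flat colouring leads to a flat
     one. *)
  have cl : closed (@kempe_step V adj 3) flat_proper.
    apply: (intro_closed (sym_connect_sym (kempe_step_sym adjC))) => c d cd.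
    by rewrite !inE => /andP[cP fl]; apply: moebius_flat_step cd.
  apply: contraNN tw2 => /(closed_connect cl).
  by rewrite !inE c1P fl1 c2P /= => <-.
case: (boolP (flat c)) => fl; apply/orP; [left | right].
  exact: flat_equiv.
exact: twisted_equiv.
Qed.

End Moebius.

End Ladder.

(** * Squares joined by links *)

(* A vertex [x] lies on the square x, h x, t (h x), t x; the edge from [x] to [r x] links
   it to a neighbouring square. *)
Section LinkedSquares.

Variables (V : finType) (adj : rel V) (r h t : V -> V) (x0 : V).

Hypothesis adjE : forall x y, adj x y = [|| y == r x, y == h x | y == t x].
Hypothesis rK : involutive r.
Hypothesis hK : involutive h.
Hypothesis tK : involutive t.
Hypothesis h_t : forall x, h (t x) = t (h x).
Hypothesis r_ht : forall x, r (h (t x)) = h (t (r x)).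
Hypothesis r_neq_h : forall x, r x != h x.
Hypothesis r_neq_t : forall x, r x != t x.
Hypothesis h_neq_t : forall x, h x != t x.
Hypothesis connected : forall Q : V -> Prop, Q x0 -> (forall x, Q x -> Q (r x)) ->
  (forall x, Q x -> Q (h x)) -> (forall x, Q x -> Q (t x)) -> forall x, Q x.

Implicit Types (c d : coloring adj 3) (x y : V).

Let adjC : symmetric adj.
Proof.
move=> x y; have inv f : involutive f -> (y == f x) = (x == f y).
  by move=> fK; rewrite eq_sym -(inj_eq (inv_inj fK)) fK.
by rewrite !adjE !inv.
Qed.

Let adj_r x : adj x (r x). Proof. by rewrite adjE eqxx. Qed.
Let adj_h x : adj x (h x). Proof. by rewrite adjE eqxx orbT. Qed.
Let adj_t x : adj x (t x). Proof. by rewrite adjE eqxx !orbT. Qed.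

Let adjP3 x y : adj x y -> [\/ y = r x, y = h x | y = t x].
Proof.
by rewrite adjE => /or3P[]/eqP->; [constructor 1 | constructor 2 | constructor 3].
Qed.

Let ecol_inv c f x : involutive f -> ecol c (f x) (f (f x)) = ecol c x (f x).
Proof. by move=> fK; rewrite fK ecolC. Qed.

Section Proper.

Variables (c : coloring adj 3) (cP : proper c).

Lemma ecol_rh x : ecol c x (r x) != ecol c x (h x).
Proof. exact: (proper_ecolP adjC c cP). Qed.

Lemma ecol_rt x : ecol c x (r x) != ecol c x (t x).
Proof. exact: (proper_ecolP adjC c cP). Qed.

Lemma ecol_ht x : ecol c x (h x) != ecol c x (t x).
Proof. exact: (proper_ecolP adjC c cP). Qed.

(** In a 3-coloured square some two opposite edges agree: if one pair differs, both remaining edges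
    meet its two colours and get the third. The ends of each other edge then see the same two
    colours, hence have equal links. *)
Lemma square_links x (R := fun y => ecol c y (r y)) :
  (R (h x) = R x /\ R (t x) = R (h (t x))) \/ (R (h x) = R (h (t x)) /\ R (t x) = R x).
Proof.
have hB : ecol c (h (t x)) (t (h (t x))) = ecol c (h x) (t (h x)).
  by rewrite h_t ecol_inv.
have [[a1 a2] a3] := (ecol_rh x, ecol_rt x, ecol_ht x).
have [[b1 b2] b3] := (ecol_rh (h x), ecol_rt (h x), ecol_ht (h x)).
have [[d1 d2] d3] := (ecol_rh (t x), ecol_rt (t x), ecol_ht (t x)).
have [[c1 c2] c3] := (ecol_rh (h (t x)), ecol_rt (h (t x)), ecol_ht (h (t x))).
rewrite (ecol_inv c _ hK) in b1 b3; rewrite (ecol_inv c _ tK) in d2 d3.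
rewrite (ecol_inv c _ hK) in c1 c3; rewrite hB in c2 c3.
have [BD|BD] := eqVneq (ecol c (h x) (t (h x))) (ecol c x (t x)).
  rewrite BD in b2 c2; left; split.
    exact: third_unique a3 b1 b2 a1 a2.
  exact: third_unique d3 d1 d2 c1 c2.
have AC : ecol c (t x) (h (t x)) = ecol c x (h x).
  by apply: third_unique BD _ _ _ _.
rewrite AC in c1 d1; right; split.
  exact: third_unique b3 b1 b2 c1 c2.
exact: third_unique a3 d1 d2 a1 a2.
Qed.

(** By [square_links], the link colours at two opposite corners of a square cover all four of its
    links; by [r_ht], links carry opposite corners to opposite corners. So two colours spread over
    the connected graph. *)
Lemma two_link_colors :
  exists y z : 'I_3, y != z /\ forall x, ecol c x (r x) \in [:: y; z].
Proof.
pose R x := ecol c x (r x).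
(* If the two starting links agree, any second colour serves as [z]. *)
pose y := R x0; pose z := if R (h (t x0)) == y then third y y else R (h (t x0)).
have R_r x : R (r x) = R x by rewrite /R rK ecolC.
have links x : (R (h x) = R x /\ R (t x) = R (h (t x))) \/
    (R (h x) = R (h (t x)) /\ R (t x) = R x) by exact: square_links.
exists y, z; split.
  rewrite eq_sym /z; case: ifP => [_|/negbT //].
  by case: (third_neq y y).
suff Q : forall x, R x \in [:: y; z] /\ R (h (t x)) \in [:: y; z] by move=> x; case: (Q x).
apply: connected => [|x|x|x].
- rewrite !inE eqxx /z; case: ifP => // _; by rewrite eqxx orbT.
- by rewrite -r_ht !R_r.
- by rewrite -h_t hK; case: (links x) => -[-> ->] [].
- by rewrite tK; case: (links x) => -[-> ->] [].
Qed.

End Proper.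

(* If the perfect matching r uses only two colours y, z, then an edge outside it
   coloured y or z joins two vertices whose r-edges have equal colours; so the
   vertices with r-edge coloured y form a union of (y, z)-chains. *)
Lemma links_monochrome c : proper c ->
  exists d (z : 'I_3), [/\ proper d, kempe_equiv c d & forall x, ecol d x (r x) = z].
Proof.
move=> cP; have [y [z [yz Ryz]]] := two_link_colors cP.
pose S x := ecol c x (r x) == y.
have other (p q u : 'I_3) : p \in [:: y; z] -> q \in [:: y; z] -> p != u -> q != u ->
    (u == y) || (u == z) -> (p == y) = (q == y).
  rewrite !inE => /orP[]/eqP-> /orP[]/eqP-> // /negPf E1 /negPf E2;
    by rewrite eq_sym E1 eq_sym E2 || rewrite eq_sym E2 eq_sym E1.
have [|d [dP cd dE]] := @kempe_move _ _ _ adjC c y z S cP.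
  move=> x x' /adjP3[]->; rewrite /S.
  - by rewrite rK ecolC.
  - apply: other => //; first exact: ecol_rh.
    by rewrite -(ecol_inv c x hK) ecol_rh.
  - apply: other => //; first exact: ecol_rt.
    by rewrite -(ecol_inv c x tK) ecol_rt.
exists d, z; split=> // x; rewrite dE // /S; have := Ryz x.
rewrite !inE; case: eqVneq => [-> _|_ /eqP //]; exact: swap_colL.
Qed.

Lemma squares_normal c : proper c -> exists d, [/\ proper d, kempe_equiv c d &
  forall x, [/\ ecol d x (r x) = col0, ecol d x (h x) = col1 & ecol d x (t x) = col2]].
Proof.
move=> /links_monochrome[d [z [dP cd dz]]].
(* Only [z] going to [col0] matters here; [third z z] fills the second slot, and the long term
   proves that it differs from [z]. *)
have [f [s [fP df sz _ fE]]] := @kempe_recolor _ _ _ adjC d z (third z z) col0 col1 dP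
  (introN eqP (fun E => elimN eqP (proj1 (third_neq z z)) (esym E))) isT.
have f0 x : ecol f x (r x) = col0 by rewrite fE // dz.
have fh0 x : ecol f x (h x) != col0 by rewrite -(f0 x) eq_sym ecol_rh.
have ft0 x : ecol f x (t x) != col0 by rewrite -(f0 x) eq_sym ecol_rt.
(* [S] collects the squares whose [h]-edges have the wrong colour; being joined to others only by
   links coloured 0, they can be switched independently. *)
pose S x := ecol f x (h x) == col2.
have St x : S (t x) = S x.
  rewrite /S (_ : ecol f (t x) (h (t x)) = ecol f x (h x)) //.
  apply: (@third_unique col0 (ecol f x (t x))) => //; first by rewrite eq_sym.
    by rewrite -(ecol_inv f x tK) ecol_ht.
  exact: ecol_ht.
have [|g [gP fg gE]] := @kempe_move _ _ _ adjC f col1 col2 S fP.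
  move=> x x' /adjP3[]->; rewrite ?St //; first by rewrite f0.
  by rewrite /S ecol_inv.
have g0 x : ecol g x (r x) = col0.
  by rewrite gE // f0 swap_col_id // if_same.
have g1 x : ecol g x (h x) = col1.
  rewrite gE // /S; case: (eqVneq _ col2) => [->|n2]; first exact: swap_colR.
  by apply: (@third_unique col0 col2).
exists g; split=> //.
  exact: kempe_equiv_trans cd (kempe_equiv_trans df fg).
move=> x; split=> //; apply: (@third_unique col0 col1) => //.
- by rewrite -(g0 x) eq_sym ecol_rt.
- by rewrite -(g1 x) eq_sym ecol_ht.
Qed.

Lemma exists_squares_coloring : exists c : coloring adj 3, proper c.
Proof.
pose f x y := if y == r x then col0 else if y == h x then col1 else col2.
have f_r x : f x (r x) = col0 by rewrite /f eqxx.
have f_h x : f x (h x) = col1 by rewrite /f eq_sym (negPf (r_neq_h x)) eqxx.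
have f_t x : f x (t x) = col2.
  by rewrite /f eq_sym (negPf (r_neq_t x)) eq_sym (negPf (h_neq_t x)).
have fC x y : adj x y -> f x y = f y x.
  case/adjP3=> ->; rewrite ?f_r ?f_h ?f_t.
  - by have := f_r (r x); rewrite rK.
  - by have := f_h (h x); rewrite hK.
  - by have := f_t (t x); rewrite tK.
exists (coloring_of adj f); apply/(proper_ecolP adjC) => x y z xy xz.
rewrite !(ecol_coloring_of fC) //.
by case/adjP3: xy => ->; case/adjP3: xz => ->; rewrite ?eqxx // ?f_r ?f_h ?f_t.
Qed.

Lemma Kprime_squares : Kprime adj 3 = 1.
Proof.
have [c0 c0P] := exists_squares_coloring.
apply: (Kprime_eq1 adjC c0P) => c cP.
have [d0 [d0P cd0 d0E]] := squares_normal c0P.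
have [d [dP cd dE]] := squares_normal cP.
apply: (kempe_equiv_trans cd0); rewrite (kempe_equiv_sym adjC).
rewrite (_ : d0 = d) //; apply: coloring_ext => x y.
by have [E1 E2 E3] := d0E x; have [F1 F2 F3] := dE x; case/adjP3=> ->; congruence.
Qed.

End LinkedSquares.

(** * The three families *)

(** The explicit wrap-around suits linear arithmetic better than a remainder. The value is always in
    range, so the default [i] of [insubd] never occurs. *)
Definition cyc_next m (i : 'I_m) : 'I_m := insubd i (if i.+1 == m then 0 else i.+1).
Definition cyc_prev m (i : 'I_m) : 'I_m := insubd i (if i == 0 :> nat then m.-1 else i.-1).

Lemma val_cyc_nextE m (i : 'I_m) : cyc_next i = (if i.+1 == m then 0 else i.+1) :> nat.
Proof. by rewrite /cyc_next val_insubd ifT //; have := ltn_ord i; case: eqP; lia. Qed.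

Lemma val_cyc_next m (i : 'I_m) : cyc_next i = i.+1 %% m :> nat.
Proof.
rewrite val_cyc_nextE; case: eqP => [->|ne]; first by rewrite modnn.
by rewrite modn_small //; have := ltn_ord i; lia.
Qed.

Lemma val_cyc_prevE m (i : 'I_m) :
  cyc_prev i = (if i == 0 :> nat then m.-1 else i.-1) :> nat.
Proof. by rewrite /cyc_prev val_insubd ifT //; have := ltn_ord i; case: eqP; lia. Qed.

Lemma cyc_nextK m : cancel (@cyc_next m) (@cyc_prev m).
Proof.
move=> i; apply: val_inj; rewrite /= val_cyc_prevE val_cyc_nextE.
by have := ltn_ord i; case: (eqVneq i.+1 m) => /=; lia.
Qed.

Lemma cyc_prevK m : cancel (@cyc_prev m) (@cyc_next m).
Proof.
move=> i; apply: val_inj; rewrite /= val_cyc_nextE val_cyc_prevE.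
by have := ltn_ord i; case: (eqVneq (i : nat) 0) => [->|]; case: ifP; lia.
Qed.

Lemma cyc_next_neq_prev m (i : 'I_m) : 2 < m -> cyc_next i != cyc_prev i.
Proof.
rewrite -val_eqE /= val_cyc_nextE val_cyc_prevE; have := ltn_ord i.
by do 2!case: ifP; lia.
Qed.

Lemma val_iter_cyc_next n m (i : 'I_m) : iter n (@cyc_next m) i = (i + n) %% m :> nat.
Proof.
elim: n => [|n IH] /=; first by rewrite addn0 modn_small.
by rewrite val_cyc_next IH -addn1 modnDml addn1 addnS.
Qed.

Lemma Kprime_ML k : 1 < k -> Kprime (ML k) 3 = if odd k then 2 else 1.
Proof.
move=> k_gt1.
pose mt (i : 'I_(2 * k)) : 'I_(2 * k) := insubd i (if i < k then i + k else i - k).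
pose pos (i : 'I_(2 * k)) : nat := if i < k then i : nat else i - k.
have m_gt0 : 0 < 2 * k by lia.
(* The remainder only makes [at_] total; it is the identity on positions below [k]. *)
pose at_ j : 'I_(2 * k) := Ordinal (ltn_pmod j m_gt0).
have val_mt i : mt i = (if i < k then i + k else i - k) :> nat.
  by rewrite /mt val_insubd ifT //; have := ltn_ord i; case: ifP; lia.
(* The rails form one cycle of even length [2 * k], so parity of the index alternates along it. *)
apply: (@Kprime_moebius _ (ML k) k (@cyc_next _) (@cyc_prev _) mt pos at_ _ _ _ _ _ _ _ _
  _ _ _ _ _ _ (fun i => odd i)) => //.
- move=> i j; rewrite /ML -!val_eqE /= !val_cyc_next val_mt.
  by have := ltn_ord i; have := ltn_ord j; case: ifP; lia.
- exact: cyc_nextK.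
- exact: cyc_prevK.
- move=> i; apply: val_inj; rewrite /= !val_mt.
  by have := ltn_ord i; do 2!case: ifP; lia.
- move=> i; apply: val_inj; rewrite /= val_cyc_nextE !val_mt val_cyc_nextE.
  by have := ltn_ord i; do 4!case: ifP; lia.
- by move=> i; apply: cyc_next_neq_prev; lia.
- move=> i; rewrite -val_eqE /= val_cyc_nextE val_mt.
  by have := ltn_ord i; do 2!case: ifP; lia.
- by move=> i; rewrite /pos; have := ltn_ord i; case: ifP; lia.
- move=> i; rewrite /pos val_cyc_nextE; have := ltn_ord i => ltik.
  case: (ltnP i k) => ik.
    case: (ltnP i.+1 k) => ik1; first by rewrite modn_small //; do 2!case: ifP; lia.
    rewrite (_ : i.+1 = k) ?modnn; last by lia.
    by do 2!case: ifP; lia.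
  case: (ltnP i.+1 (2 * k)) => ik1; first by rewrite modn_small //; do 2?case: ifP; lia.
  rewrite (_ : (i - k).+1 = k) ?modnn; last by lia.
  by do 2?case: ifP; lia.
- move=> i; rewrite /pos val_mt; have := ltn_ord i.
  by case: (ltnP i k) => ik; case: ifP; lia.
- by move=> i ik; rewrite /pos /= modn_small ?ik //; lia.
- move=> i j; rewrite /pos => E; have := ltn_ord i; have := ltn_ord j.
  have [/val_inj|ij] := eqVneq (val j) (val i); first by left.
  move=> jk ik; right; apply: val_inj; rewrite /= val_mt.
  by move: ij E; rewrite /=; do 2!case: ifP; lia.
- move=> i; apply: val_inj; rewrite /= val_iter_cyc_next val_mt; have := ltn_ord i.
  case: (ltnP i k) => ik ltik; first by rewrite modn_small //; lia.
  rewrite (_ : i + k = (i - k) + 2 * k); last by lia.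
  by rewrite modnDr modn_small //; lia.
- by move=> i; rewrite val_cyc_nextE; case: eqP => //; lia.
Qed.

Lemma Kprime_Pr k : 2 < k -> Kprime (Pr k) 3 = 1.
Proof.
move=> k_gt2; have k_gt0 : 0 < k by lia.
pose nx (u : 'I_k * bool) := (cyc_next u.1, u.2).
pose px (u : 'I_k * bool) := (cyc_prev u.1, u.2).
pose mt (u : 'I_k * bool) := (u.1, ~~ u.2).
pose pos (u : 'I_k * bool) : nat := u.1.
pose at_ j := (Ordinal (ltn_pmod j k_gt0), false).
(* The boolean component tells the two rail cycles apart. *)
apply: (@Kprime_untwisted _ (Pr k) k nx px mt pos at_ _ _ _ _ _ _ _ _
  _ _ _ _ _ (fun u => u.2)) => //.
- exact: ltnW.
- move=> [i s] [j s']; rewrite /Pr /nx /mt !xpair_eqE -!val_eqE /= !val_cyc_next.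
  by case: s; case: s'; rewrite /= ?andbT ?andbF ?orbF // eq_sym.
- by move=> [i s]; rewrite /nx /px /= cyc_nextK.
- by move=> [i s]; rewrite /nx /px /= cyc_prevK.
- by move=> [i s]; rewrite /mt /= negbK.
- by move=> [i s]; rewrite /nx /px xpair_eqE negb_and cyc_next_neq_prev.
- by move=> [i s]; rewrite /nx /mt xpair_eqE negb_and /=; case: s; rewrite orbT.
- by move=> [i s]; apply: ltn_ord.
- by move=> [i s]; rewrite /pos /nx /= val_cyc_next.
- by move=> j jk; rewrite /pos /= modn_small.
- move=> [i s] [j s'] /val_inj/= ->; rewrite /mt /=.
  by case: s; case: s'; [left | right | right | left].
Qed.

Lemma Kprime_CPr k : 1 < k -> Kprime (CPr k) 3 = 1.
Proof.
move=> k_gt1; have m_gt0 : 0 < 2 * k by lia.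
(* The indices [2m] and [2m + 1] of both cycles span a square: [h] is its cycle edge, [t] its
   crossing edge, and [r] the cycle edge leaving it. *)
pose r (u : 'I_(2 * k) * bool) := (if odd u.1 then cyc_next u.1 else cyc_prev u.1, u.2).
pose h (u : 'I_(2 * k) * bool) := (if odd u.1 then cyc_prev u.1 else cyc_next u.1, u.2).
pose t (u : 'I_(2 * k) * bool) := ((h u).1, ~~ u.2).
have odd_next (i : 'I_(2 * k)) : odd (cyc_next i) = ~~ odd i.
  by rewrite val_cyc_nextE; case: eqP => //; lia.
have odd_prev (i : 'I_(2 * k)) : odd (cyc_prev i) = ~~ odd i.
  by rewrite -{2}[i]cyc_prevK odd_next negbK.
have rK : involutive r.
  move=> [i s]; rewrite /r /=; case oi: (odd i); rewrite /= ?odd_next ?odd_prev oi /=;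
    by rewrite ?cyc_nextK ?cyc_prevK.
have hK : involutive h.
  move=> [i s]; rewrite /h /=; case oi: (odd i); rewrite /= ?odd_next ?odd_prev oi /=;
    by rewrite ?cyc_nextK ?cyc_prevK.
have tE u : t u = ((h u).1, ~~ u.2) by [].
have h_t u : h (t u) = (u.1, ~~ u.2) by rewrite -(congr1 fst (hK u)).
have t_h u : t (h u) = (u.1, ~~ u.2) by rewrite tE hK.
have next_prev (i : 'I_(2 * k)) : cyc_next i != cyc_prev i by apply: cyc_next_neq_prev; lia.
apply: (@Kprime_squares _ (CPr k) r h t (Ordinal m_gt0, false)) => //.
- move=> [i s] [j s']; rewrite /CPr /r /h /t /h /= !xpair_eqE.
  rewrite !(fun_if (fun z => j == z)) -!val_eqE /= !val_cyc_nextE !val_cyc_prevE.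
  rewrite -!val_cyc_next !val_cyc_nextE.
  have := ltn_ord i; have := ltn_ord j.
  by case: s; case: s'; rewrite /= ?andbT ?andbF ?orbF; do ?case: ifP; lia.
- by move=> [i s]; rewrite tE h_t negbK.
- by move=> [i s]; rewrite !h_t.
- move=> [i s]; rewrite /r /h xpair_eqE eqxx andbT /=; case: ifP => _ //.
  by rewrite eq_sym.
- by move=> [i s]; rewrite /r xpair_eqE; case: s; rewrite andbF.
- by move=> [i s]; rewrite /h xpair_eqE; case: s; rewrite andbF.
- move=> Q Q0 Qr Qh Qt [[i ltik] s].
  (* Going to the opposite corner changes the cycle but not the index, so it remains to walk along
     one cycle, alternately by [h] and [r]. *)
  have flip u : Q u -> Q (u.1, ~~ u.2) by move=> Qu; rewrite -h_t; apply/Qh/Qt.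
  suff Qi : Q (Ordinal ltik, false) by case: s; [apply: (flip _ Qi) |].
  elim: i ltik => [|i IH] ltik.
    by rewrite (_ : Ordinal ltik = Ordinal m_gt0) //; apply: val_inj.
  have ltik' : i < 2 * k by lia.
  have next_i : cyc_next (Ordinal ltik') = Ordinal ltik.
    by apply: val_inj; rewrite /= val_cyc_nextE ifF //=; lia.
  have := Qr _ (IH ltik'); have := Qh _ (IH ltik').
  by rewrite /r /h /= next_i; case: (odd i).
Qed.

Theorem theorem24 :
  (forall k : nat, 2 <= k -> Kprime (ML k) 3 = (if odd k then 2 else 1)) /\
  (forall k : nat, 3 <= k -> Kprime (Pr k) 3 = 1) /\
  (forall k : nat, 2 <= k -> Kprime (CPr k) 3 = 1).
Proof. exact: (conj Kprime_ML (conj Kprime_Pr Kprime_CPr)). Qed.
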